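(* Let $m,n\in\mathbb{N}=\{1,2,3,\ldots\}$, let $d\ge 0$ be an integer, let $\mathbf{x}\in[n+1]^m$, and let $\mathbf{x}'=(x_1',x_2',\ldots,x_m')$ be the rearrangement of $\mathbf{x}$ into nondecreasing order. Then $\mathbf{x}$ is a defective parking function with defect $d$ (i.e. $\mathbf{x}\in\mathrm{DPF}_{m,n,d}$) if and only if \[\max\Big(\max_{j\in[m]}\big(x_j'-j+(m-n)\big),\,0\Big)=d.\]
   Context: $[n]=\{1,\ldots,n\}$. A preference list is a tuple $\mathbf{x}=(x_1,\ldots,x_m)\in[n+1]^m$. Cars $1,2,\ldots,m$ arrive in order at an infinitely long one-way street with spots numbered $1,2,3,\ldots$; car $i$ drives to spot $x_i$ and parks there if it is empty, and otherwise parks in the first empty spot after $x_i$. The spots $1,\ldots,n$ constitute the parking lot. The defect $\mathrm{dft}(\mathbf{x})$ is the number of cars that park in a spot numbered greater than $n$ (equivalently, the number of cars that fail to park in the lot under the classical parking scheme). $\mathrm{DPF}_{m,n,d}$ denotes the set of $\mathbf{x}\in[n+1]^m$ with $\mathrm{dft}(\mathbf{x})=d$. *)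

(* Defs.v *)
From mathcomp Require Import all_boot all_order all_algebra.
Import Order.TTheory GRing.Theory Num.Theory.

Lemma ex_empty_spot (occ : seq nat) (a : nat) :
  exists s, (a <= s) && (s \notin occ).
Proof.
exists (a + (sumn occ).+1); rewrite leq_addr /=; apply/negP => occ_s.
have : a + (sumn occ).+1 <= sumn occ.
  elim: occ {a}(a + _) occ_s => // b occ IH s; rewrite inE /=.
  by case/predU1P=> [->|/IH/leq_trans->//]; rewrite ?leq_addr ?leq_addl.
by apply/negP; rewrite -ltnNge addnS ltnS leq_addl.
Qed.

(* [occ] lists the occupied spots; the street is the set of positive naturals,
   so spot 0 is never reached because preferences are at least 1. *)
Definition first_empty_spot (occ : seq nat) (a : nat) : nat :=
  ex_minn (ex_empty_spot occ a).

(* Entry i (counting from 0) is the spot in which car i+1 parks. *)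
Definition parking_outcome (x : seq nat) : seq nat :=
  foldl (fun occ a => rcons occ (first_empty_spot occ a)) [::] x.

Definition dft (n : nat) (x : seq nat) : nat :=
  count (fun s => n < s) (parking_outcome x).

Definition pref_list (m n : nat) : pred (m.-tuple nat) :=
  fun x => all (fun a => 1 <= a <= n.+1) x.

Definition DPF (m n d : nat) : pred (m.-tuple nat) :=
  fun x => (x \in pref_list m n) && (dft n x == d).

(* Only meaningful for nonempty [s]: the seed is then a member of [s], so no
   extra value enters the maximum. *)
Definition maxz (s : seq int) : int :=
  \big[Num.max/head 0%R s]_(a <- s) a.

(* Main.v *)
Require Import Defs.
From mathcomp Require Import all_boot all_order all_algebra.
From mathcomp Require Import zify.
Import Order.TTheory GRing.Theory Num.Theory.

(** The defect is governed by the numbers of cars preferring a spot beyond [b].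
    Such cars park beyond [b], so for every [b <= n] at least
    [#{i | b < x_i} - (n - b)] cars overflow; equality holds when [b] is the
    last empty spot of the lot (with [b = 0] if the lot is full), because no car
    can drive past a spot that stays empty.  In the sorted list the entry
    [x'_j] satisfies [x'_j > b] exactly when at least [m - j + 1] cars prefer a
    spot beyond [b], which turns these counts into the order statistics. *)

Lemma parking_outcome_rcons (x : seq nat) (p : nat) :
  parking_outcome (rcons x p) =
  rcons (parking_outcome x) (first_empty_spot (parking_outcome x) p).
Proof. by rewrite /parking_outcome foldl_rcons. Qed.

Lemma first_empty_spot_notin (occ : seq nat) (a : nat) :
  first_empty_spot occ a \notin occ.
Proof. by rewrite /first_empty_spot; case: ex_minnP => s /andP[]. Qed.

Lemma first_empty_spot_ge (occ : seq nat) (a : nat) :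
  a <= first_empty_spot occ a.
Proof. by rewrite /first_empty_spot; case: ex_minnP => s /andP[]. Qed.

Lemma first_empty_spot_occupied (occ : seq nat) (a t : nat) :
  a <= t < first_empty_spot occ a -> t \in occ.
Proof.
rewrite /first_empty_spot; case: ex_minnP => s _ smin /andP[at_ ts].
apply: contraLR ts => tocc; rewrite -leqNgt; apply: smin.
by rewrite at_ tocc.
Qed.

Lemma parking_outcome_uniq (x : seq nat) : uniq (parking_outcome x).
Proof.
elim/last_ind: x => // x p IH.
by rewrite parking_outcome_rcons rcons_uniq first_empty_spot_notin.
Qed.

Lemma parking_outcome_gt0 (x : seq nat) :
  0 \notin x -> 0 \notin parking_outcome x.
Proof.
elim/last_ind: x => // x p IH.
rewrite parking_outcome_rcons !mem_rcons !inE !negb_or => /andP[p0 /IH->].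
by have := first_empty_spot_ge (parking_outcome x) p; lia.
Qed.

Lemma count_pref_gt_le (x : seq nat) (b : nat) :
  count (ltn b) x <= count (ltn b) (parking_outcome x).
Proof.
elim/last_ind: x => // x p IH.
rewrite parking_outcome_rcons -!cats1 !count_cat /=.
by have := first_empty_spot_ge (parking_outcome x) p; lia.
Qed.

(** A car preferring a spot up to [b] and parking beyond it would have found [b] occupied, and
    occupied spots stay occupied. *)
Lemma count_outcome_gt_le (x : seq nat) (b : nat) :
  b \notin parking_outcome x ->
  count (ltn b) (parking_outcome x) <= count (ltn b) x.
Proof.
elim/last_ind: x => // x p IH.
rewrite parking_outcome_rcons mem_rcons inE negb_or => /andP[_ bx].
rewrite -!cats1 !count_cat /= leq_add ?IH // !addn0.
case: (ltnP b p) => [_|pb]; first by case: (b < _).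
case: ltnP => // bs.
by rewrite (@first_empty_spot_occupied _ p b) ?pb in bx.
Qed.

(** Without repetitions, the entries of [s] in the interval from [b + 1] to [n] correspond to the
    spots of that interval lying in [s]. *)
Lemma count_interval_uniq (s : seq nat) (b n : nat) : uniq s -> b <= n ->
  count (ltn b) s = count (ltn n) s + count [in s] (iota b.+1 (n - b)).
Proof.
move=> us bn.
have -> : count (ltn b) s = count (ltn n) s + count (fun t => b < t <= n) s.
  by elim: s {us} => //= t s ->; lia.
congr (_ + _); rewrite -!size_filter; apply/perm_size/uniq_perm.
- exact: filter_uniq.
- exact/filter_uniq/iota_uniq.
by move=> t; rewrite !mem_filter mem_iota /= andbC; case: (t \in s) => //=; lia.
Qed.

Lemma dft_lower_bound (n : nat) (x : seq nat) (b : nat) : b <= n ->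
  count (ltn b) x <= dft n x + (n - b).
Proof.
move=> bn; apply: leq_trans (count_pref_gt_le x b) _.
rewrite (@count_interval_uniq _ b n) ?parking_outcome_uniq // leq_add2l.
by rewrite -[leqRHS](size_iota b.+1) count_size.
Qed.

Lemma dft_attained (n : nat) (x : seq nat) : 0 \notin x ->
  exists2 b, b <= n & dft n x + (n - b) <= count (ltn b) x.
Proof.
move=> /parking_outcome_gt0 x0.
(* Spot 0 is always empty, so a maximal empty [b] exists even when the lot is full. *)
have exb : exists b, (b <= n) && (b \notin parking_outcome x) by exists 0.
have ubb b : (b <= n) && (b \notin parking_outcome x) -> b <= n by case/andP.
case: (ex_maxnP exb ubb) => b /andP[bn bx] bmax; exists b => //.
apply: leq_trans (count_outcome_gt_le x b bx).
rewrite (@count_interval_uniq _ b n) ?parking_outcome_uniq // leq_add2l.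
(* By maximality of [b], all [n - b] spots after it in the lot are taken. *)
suff : all [in parking_outcome x] (iota b.+1 (n - b)).
  by rewrite all_count size_iota => /eqP->.
apply/allP => t; rewrite mem_iota => tb; apply: contraT => tx.
by have := bmax t; rewrite tx andbT; lia.
Qed.

Lemma nth_sort_gtE (x : seq nat) (b j : nat) : j < size x ->
  (b < nth 0 (sort leq x) j) = (size x - j <= count (ltn b) x).
Proof.
have -> : count (ltn b) x = count (ltn b) (sort leq x).
  exact/esym/permP/permEl/perm_sort.
rewrite -(size_sort leq) => js.
have ss : sorted leq (sort leq x) := sort_sorted leq_total x.
move: (sort leq x) js ss => {x} s js ss.
have mono i k : i <= k < size s -> nth 0 s i <= nth 0 s k.
  case/andP=> ik ks; have is_ := leq_ltn_trans ik ks.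
  exact: (sorted_leq_nth leq_trans leqnn 0 ss i k is_ ks ik).
apply/idP/idP => [bs|].
  have /eqP cd : count (ltn b) (drop j s) == size (drop j s).
    rewrite -all_count; apply/(all_nthP 0) => i; rewrite size_drop nth_drop /= => ij.
    by apply: leq_trans bs _; apply: mono; lia.
  by rewrite -[s in count _ s](cat_take_drop j) count_cat cd size_drop leq_addl.
apply: contraLR; rewrite -leqNgt -ltnNge => sb.
(* If entry [j] is at most [b], so are the first [j + 1] entries, leaving at most [size s - j - 1]
   larger ones. *)
have ct : count (ltn b) (take j.+1 s) = 0.
  apply/eqP; rewrite -leqn0 leqNgt -has_count; apply/(has_nthP 0) => -[i].
  rewrite size_take_min leq_min => /andP[ij _] /=; rewrite nth_take //.
  by have := mono i j; lia.
rewrite -[s in count _ s](cat_take_drop j.+1) count_cat ct.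
rewrite add0n; apply: leq_ltn_trans (count_size _ _) _.
by rewrite size_drop; lia.
Qed.

(** The seed is the head of [s], so it is bounded by [c] as soon as all members are. *)
Lemma maxz_le (s : seq int) (c : int) :
  s != [::] -> (maxz s <= c)%R = all (fun a => (a <= c)%R) s.
Proof.
case: s => // a s _; rewrite /maxz /=; apply/idP/andP.
  move=> mc; split; last apply/allP => t ts; apply: le_trans mc;
    by apply: le_bigmax_seq => //; rewrite inE ?eqxx ?ts ?orbT.
case=> ac /allP sc; rewrite big_seq; apply: bigmax_le => // t.
by rewrite inE => /predU1P[->|/sc].
Qed.

Theorem theorem1p2 (m n d : nat) (m_gt0 : 0 < m) (n_gt0 : 0 < n)
    (x : m.-tuple nat) (hx : x \in pref_list m n) :
  let x' : m.-tuple nat := [tuple of sort leq x] in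
  x \in DPF m n d <->
  Num.max (maxz [seq ((tnth x' j)%:Z - (j.+1)%:Z + (m%:Z - n%:Z))%R | j : 'I_m])
    0%R = d%:Z%R.
Proof.
move=> x'; set s := [seq _ | j : 'I_m].
have /allP xn : all (fun a => 1 <= a <= n.+1) x by exact: hx.
have x0 : 0 \notin x by apply/negP => /xn.
have s0 : s != [::] by rewrite -size_eq0 size_map size_enum_ord -lt0n.
have x'E (j : 'I_m) (b : nat) : (b < tnth x' j) = (m - j <= count (ltn b) x).
  by rewrite (tnth_nth 0) nth_sort_gtE ?size_tuple.
suff -> : Num.max (maxz s) 0%R = (dft n x)%:Z%R.
  rewrite /DPF unfold_in hx /=.
  by split=> [/eqP->|[->]].
apply/le_anti/andP; split.
  rewrite ge_max maxz_le // andbT.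
  apply/allP => _ /mapP[j _ ->].
  have xj : tnth x' j \in x by rewrite -(mem_sort leq) mem_tnth.
  (* The threshold just below [x'_j] is at most [n] because preferences are at most [n + 1]; at
     least [m - j] cars exceed it, [j] counting from 0. *)
  have := x'E j (tnth x' j).-1; have := @dft_lower_bound n x (tnth x' j).-1.
  by have := xn _ xj; lia.
rewrite leNgt; apply/negP; rewrite gt_max => /andP[sD D0].
have [b bn Db] := dft_attained n x x0.
have cm : count (ltn b) x <= m by rewrite -[leqRHS](size_tuple x) count_size.
(* This is the 0-based position of the smallest entry exceeding [b]; one exists because the defect
   is positive by [D0]. *)
have jm : m - count (ltn b) x < m by lia.
pose j := Ordinal jm.
have bx : b < tnth x' j by rewrite x'E /=; lia.
have : (maxz s <= (dft n x)%:Z - 1)%R by lia.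
rewrite maxz_le // => /allP/(_ _ (map_f _ (mem_enum _ j))) /=.
by lia.
Qed.
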